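(* Let $n \ge 3$, let $\mathbf{r}_{\mathrm{app}}$ and $\mathbf{r}_{\mathrm{pos}}$ be any two sum-zero vectors in $\mathbb{Q}^n$, and let $\mathbf{w}$ be any nontrivial sum-zero weighting vector in $\mathbb{Q}^n$. Then there exist infinitely many ranked approval profiles $\mathbf{p} = (\mathbf{p}_1, \mathbf{p}_2, \dots, \mathbf{p}_{n-1})$ such that the approval voting outcome of $\mathbf{p}$ is $\mathbf{r}_{\mathrm{app}}$, and the positional voting outcome of $\mathbf{p}$ with respect to $\mathbf{w}$ is $\mathbf{r}_{\mathrm{pos}}$.
   Context: A vector in $\mathbb{Q}^n$ is sum-zero if its entries sum to $0$, and a sum-zero vector is nontrivial if it is not the zero vector. For $\mathbf{v} \in \mathbb{Q}^n$, $\widehat{\mathbf{v}}$ denotes the orthogonal projection of $\mathbf{v}$ onto the subspace of sum-zero vectors, i.e. $\widehat{\mathbf{v}} = \mathbf{v} - \frac{1}{n}\left(\sum_i v_i\right)\mathbf{1}$, where $\mathbf{1}$ is the all-ones vector. A full ranking of the $n$ candidates $1,\dots,n$ is identified with the permutation $\sigma \in S_n$ for which $\sigma(j)$ is the candidate ranked in position $j$; accordingly a profile of full rankings is an element $\mathbf{q} = \sum_{\sigma} q_\sigma \sigma$ of the group ring $\mathbb{Q}S_n$ (rational coefficients). $\mathbb{Q}S_n$ acts on $\mathbb{Q}^n$ linearly, with $(\sigma \mathbf{v})_j = v_{\sigma^{-1}(j)}$ for $\sigma \in S_n$; thus $\mathbf{q}\mathbf{v}$ is the vector of points received by the candidates when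 the weighting vector $\mathbf{v}$ (giving $v_j$ points for position $j$) is used. A ranked approval profile is a tuple $\mathbf{p} = (\mathbf{p}_1,\dots,\mathbf{p}_{n-1})$ with each $\mathbf{p}_i \in \mathbb{Q}S_n$; $\mathbf{p}_i$ records the full rankings of those voters who approve of exactly their top $i$ candidates. Let $\mathbf{a}_i = (1,\dots,1,0,\dots,0) \in \mathbb{Q}^n$ with $i$ ones followed by $n-i$ zeros. The approval voting outcome of $\mathbf{p}$ means the sum-zero portion of the approval voting result, namely $\mathbf{p}_1\widehat{\mathbf{a}}_1 + \mathbf{p}_2\widehat{\mathbf{a}}_2 + \cdots + \mathbf{p}_{n-1}\widehat{\mathbf{a}}_{n-1}$. The positional voting outcome of $\mathbf{p}$ with respect to $\mathbf{w}$ means $(\mathbf{p}_1 + \mathbf{p}_2 + \cdots + \mathbf{p}_{n-1})\widehat{\mathbf{w}}$ (and $\widehat{\mathbf{w}} = \mathbf{w}$ when $\mathbf{w}$ is sum-zero). *)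

(* Defs.v *)
From mathcomp Require Import all_boot all_order all_fingroup all_algebra.
From mathcomp Require Import boolp classical_sets cardinality.

Set Implicit Arguments.
Unset Strict Implicit.
Unset Printing Implicit Defensive.

Import GRing.Theory Num.Theory.

Local Open Scope ring_scope.

(* Candidates and positions are numbered 0, ..., n-1 instead of 1, ..., n. *)

Definition sum_zero (n : nat) (v : 'cV[rat]_n) : Prop :=
  \sum_(i < n) v i 0 = 0.

Definition hat (n : nat) (v : 'cV[rat]_n) : 'cV[rat]_n :=
  v - (n%:R^-1 * \sum_(i < n) v i 0) *: const_mx 1.

(* Underlying vector space of the group ring QS_n, an element being given by
   its coefficients.  The pointwise product of the library on {ffun _ -> _} is
   not the group ring product; no product of QS_n is needed here. *)
Notation group_ring n := {ffun 'S_n -> rat}.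

(* This is a left action for the composition (s t)(j) = s (t j), which is
   [t * s] for the product of permutations of the library. *)
Definition perm_act (n : nat) (s : 'S_n) (v : 'cV[rat]_n) : 'cV[rat]_n :=
  \col_(j < n) v ((s^-1)%g j) 0.

Definition gr_act (n : nat) (q : group_ring n) (v : 'cV[rat]_n) : 'cV[rat]_n :=
  \sum_(s : 'S_n) q s *: perm_act s v.

Definition approval_vec (n k : nat) : 'cV[rat]_n :=
  \col_(j < n) (if (j < k)%N then 1 else 0).

(* The component of index i : 'I_n.-1 is p_(i+1): it records the rankings of
   the voters who approve of exactly their top i+1 candidates. *)
Definition ranked_approval_profile (n : nat) : Type :=
  {ffun 'I_n.-1 -> group_ring n}.

Definition approval_outcome (n : nat) (p : ranked_approval_profile n) :
    'cV[rat]_n :=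
  \sum_(i < n.-1) gr_act (p i) (hat (approval_vec n i.+1)).

Definition positional_outcome (n : nat) (w : 'cV[rat]_n)
    (p : ranked_approval_profile n) : 'cV[rat]_n :=
  gr_act (\sum_(i < n.-1) p i) (hat w).

(* Main.v *)
Require Import Defs.
From mathcomp Require Import all_boot all_order all_fingroup all_algebra.
From mathcomp Require Import boolp classical_sets cardinality.
From mathcomp Require Import ring.

(** As soon as a vector v has two distinct entries, the vectors q v, for q in
    the group ring, include every sum-zero vector: if a permutation s
    moves the two distinct entries of v to positions a and b, then s v
    and its image under the transposition of a and b differ by a nonzero
    multiple of e_a - e_b, and these differences span the sum-zero vectors
    ([gr_act_onto_sum_zero]).

    Two kinds of ballots already suffice.  If A and C - A are the profiles of
    the voters approving their top candidate and their top two candidates, then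
    the positional outcome is C w while the approval outcome is
    A (a_1 - a_2) + C a_2, where the a_k are the projected approval vectors.
    Hence one first picks C with C w = r_pos, and then A with
    A (a_1 - a_2) = r_app - C a_2; both equations are solvable since neither w
    nor a_1 - a_2 is constant.

    Infinitely many profiles arise because a_1 - a_2 takes the same value at the
    first and third positions, so that it is killed by K = 1 - (0 2): A may be
    replaced by A + t K for every natural number t, with C kept fixed. *)

Set Implicit Arguments.
Unset Strict Implicit.
Unset Printing Implicit Defensive.

Import GRing.Theory Num.Theory.

Local Open Scope ring_scope.

Lemma gr_actD n (q1 q2 : group_ring n) v :
  gr_act (q1 + q2) v = gr_act q1 v + gr_act q2 v.
Proof.
by rewrite /gr_act -big_split; apply: eq_bigr => s _; rewrite ffunE scalerDl.
Qed.

Lemma gr_actB n (q1 q2 : group_ring n) v :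
  gr_act (q1 - q2) v = gr_act q1 v - gr_act q2 v.
Proof.
by rewrite /gr_act -sumrB; apply: eq_bigr => s _; rewrite !ffunE scalerBl.
Qed.

Lemma gr_act0 n (v : 'cV[rat]_n) : gr_act 0 v = 0.
Proof. by rewrite /gr_act big1 // => s _; rewrite ffunE scale0r. Qed.

Lemma gr_actMn n (q : group_ring n) v t : gr_act (q *+ t) v = gr_act q v *+ t.
Proof.
by elim: t => [|t IHt]; rewrite ?gr_act0 // !mulrS gr_actD IHt.
Qed.

Lemma gr_actBr n (q : group_ring n) v1 v2 :
  gr_act q (v1 - v2) = gr_act q v1 - gr_act q v2.
Proof.
rewrite /gr_act -sumrB; apply: eq_bigr => s _; rewrite -scalerBr.
by congr (_ *: _); apply/colP => j; rewrite !mxE.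
Qed.

Definition gr_delta n (c : rat) (s : 'S_n) : group_ring n :=
  [ffun t => if t == s then c else 0].

Lemma gr_act_delta n c (s : 'S_n) v :
  gr_act (gr_delta c s) v = c *: perm_act s v.
Proof.
rewrite /gr_act (bigD1 s) //= ffunE eqxx big1 ?addr0 // => t /negPf ts.
by rewrite ffunE ts scale0r.
Qed.

Lemma gr_act_sum n (v : 'cV[rat]_n) (I : finType) (q : I -> group_ring n) :
  gr_act (\sum_i q i) v = \sum_i gr_act (q i) v.
Proof.
exact: (big_morph _ (fun q1 q2 => gr_actD q1 q2 v) (gr_act0 v)).
Qed.

Lemma perm_2transitive (T : finType) (i j a b : T) :
  i != j -> a != b -> exists s : {perm T}, s i = a /\ s j = b.
Proof.
move=> ij ab; have ja : tperm i a j != a.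
  by rewrite -[X in _ != X](tpermL i a) (inj_eq perm_inj) eq_sym.
exists (tperm i a * tperm (tperm i a j) b)%g.
by rewrite !permM !tpermL tpermD // eq_sym.
Qed.

(** Let s move the entries v_i and v_j to a and b.  Then s v and its image under
    the transposition of a and b agree off a and b, and their difference is
    (v_i - v_j) (e_a - e_b); it remains to rescale. *)
Lemma gr_act_onto_root n (v : 'cV[rat]_n) (i j a b : 'I_n) (c : rat) :
    v i 0 != v j 0 ->
  exists q, gr_act q v = c *: (delta_mx a 0 - delta_mx b 0).
Proof.
move=> vij; have ij : i != j by apply: contraNneq vij => ->.
have [->|ab] := eqVneq a b.
  by exists 0; rewrite gr_act0 subrr scaler0.
have [s [sia sjb]] := perm_2transitive ij ab.
pose d := c / (v i 0 - v j 0).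
exists (gr_delta d s - gr_delta d (s * tperm a b)%g).
rewrite gr_actB !gr_act_delta -scalerBr.
apply/colP => k; rewrite !mxE invMg permM tpermV.
have sVa : (s^-1)%g a = i by rewrite -sia permK.
have sVb : (s^-1)%g b = j by rewrite -sjb permK.
have nz : v i 0 - v j 0 != 0 by rewrite subr_eq0.
have [->|ka] := eqVneq k a.
  by rewrite tpermL sVa sVb (negPf ab) /= /d; field.
have [->|kb] := eqVneq k b.
  by rewrite tpermR sVa sVb /= /d; field.
by rewrite tpermD 1?eq_sym // !subrr !mulr0.
Qed.

(** A sum-zero vector r is the combination of the e_a - e_b, with b fixed, whose
    coefficients are its own entries r_a. *)
Lemma gr_act_onto_sum_zero n (v r : 'cV[rat]_n) (i j : 'I_n) :
  v i 0 != v j 0 -> sum_zero r -> exists q, gr_act q v = r.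
Proof.
move=> vij r0.
have [q qE] := choice (fun a => gr_act_onto_root a i (r a 0) vij).
exists (\sum_a q a); rewrite gr_act_sum (eq_bigr _ (fun a _ => qE a)).
under eq_bigr => a _ do rewrite scalerBr.
rewrite sumrB -scaler_suml [X in X *: _]r0 scale0r subr0.
by rewrite [RHS]matrix_sum_delta; apply: eq_bigr => a _; rewrite big_ord1.
Qed.

Lemma sum_zeroB n (u v : 'cV[rat]_n) :
  sum_zero u -> sum_zero v -> sum_zero (u - v).
Proof.
move=> u0 v0; rewrite /sum_zero; under eq_bigr => k _ do rewrite !mxE.
by rewrite sumrB u0 v0 subrr.
Qed.

Lemma sum_zero_hat n (v : 'cV[rat]_n.+1) : sum_zero (hat v).
Proof.
rewrite /sum_zero /hat; under eq_bigr => k _ do rewrite !mxE mulr1.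
rewrite sumrB sumr_const card_ord -[X in _ - X]mulr_natl mulVKf ?subrr //.
by rewrite pnatr_eq0.
Qed.

Lemma sum_zero_perm_act n (s : 'S_n) v : sum_zero v -> sum_zero (perm_act s v).
Proof.
rewrite /sum_zero => v0; under eq_bigr => k _ do rewrite mxE.
by rewrite -[RHS]v0 [RHS](reindex_inj (@perm_inj _ (s^-1)%g)).
Qed.

Lemma sum_zero_gr_act n (q : group_ring n) v :
  sum_zero v -> sum_zero (gr_act q v).
Proof.
move=> v0; rewrite /sum_zero /gr_act.
under eq_bigr => k _ do rewrite summxE.
rewrite exchange_big big1 //= => s _.
under eq_bigr => k _ do rewrite mxE.
by rewrite -mulr_sumr [X in _ * X]sum_zero_perm_act ?mulr0.
Qed.

Lemma hat_id n (v : 'cV[rat]_n) : sum_zero v -> hat v = v.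
Proof. by move=> v0; rewrite /hat [X in _ * X]v0 mulr0 scale0r subr0. Qed.

(** Projecting shifts all entries equally, so differences of entries survive. *)
Lemma hatB_diff n (u v : 'cV[rat]_n) (i j : 'I_n) :
  (hat u - hat v) i 0 - (hat u - hat v) j 0 =
  (u i 0 - u j 0) - (v i 0 - v j 0).
Proof. by rewrite /hat !mxE; ring. Qed.

Lemma nontrivial_sum_zero_nonconstant n (w : 'cV[rat]_n.+1) :
  sum_zero w -> w <> 0 -> exists i, w i 0 != w 0 0.
Proof.
move=> w0 wN0; apply/existsP; apply: contra_notT wN0.
move=> /existsPn wconst.
have wE k : w k 0 = w 0 0 by apply/eqP; rewrite -[_ == _]negbK.
apply/colP => k; rewrite mxE wE; apply/eqP; move/eqP: w0.
by rewrite (eq_bigr _ (fun i _ => wE i)) sumr_const card_ord mulrn_eq0.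
Qed.

Lemma gr_act_1_tperm n (v : 'cV[rat]_n) (a b : 'I_n) :
  v a 0 = v b 0 -> gr_act (gr_delta 1 1%g - gr_delta 1 (tperm a b)) v = 0.
Proof.
move=> vab; rewrite gr_actB !gr_act_delta -scalerBr scale1r.
apply/colP => k; rewrite !mxE tpermV invg1 perm1.
by case: tpermP => [->|->|_ _]; rewrite ?vab subrr.
Qed.

(** Index i stands for approving i + 1 candidates: A and B are the ballots of
    the voters approving one and two candidates, respectively. *)
Definition two_level_profile m (A B : group_ring m.+3) :
    ranked_approval_profile m.+3 :=
  [ffun i : 'I_m.+2 =>
     if i == 0 :> nat then A else if i == 1 :> nat then B else 0].

Lemma two_level_profile_sum m (V : nmodType) (A B : group_ring m.+3)
    (F : 'I_m.+2 -> group_ring m.+3 -> V) :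
    (forall i, F i 0 = 0) ->
  \sum_i F i (two_level_profile A B i) = F 0 A + F (lift ord0 0) B.
Proof.
move=> F0; rewrite !big_ord_recl !ffunE /= big1 ?addr0 // => i _.
by rewrite ffunE /= F0.
Qed.

Lemma approval_outcome_two_level m (A B : group_ring m.+3) :
  approval_outcome (two_level_profile A B) =
  gr_act A (hat (approval_vec m.+3 1)) + gr_act B (hat (approval_vec m.+3 2)).
Proof.
pose F (i : 'I_m.+2) q := gr_act q (hat (approval_vec m.+3 i.+1)).
by apply: (@two_level_profile_sum m _ A B F) => i; apply: gr_act0.
Qed.

Lemma positional_outcome_two_level m (A B : group_ring m.+3) w :
  positional_outcome w (two_level_profile A B) = gr_act (A + B) (hat w).
Proof.
rewrite /positional_outcome.
by rewrite (@two_level_profile_sum m _ A B (fun _ q => q)).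
Qed.

Theorem theorem2 (n : nat) (hn : (3 <= n)%N) (r_app r_pos w : 'cV[rat]_n)
    (r_app0 : sum_zero r_app) (r_pos0 : sum_zero r_pos)
    (w0 : sum_zero w) (w_nontrivial : w <> 0) :
  infinite_set [set p : ranked_approval_profile n |
    approval_outcome p = r_app /\ positional_outcome w p = r_pos]%classic.
Proof.
case: n hn => [|[|[|m]]] // _ in r_app r_pos w r_app0 r_pos0 w0 w_nontrivial *.
pose a1 := hat (approval_vec m.+3 1); pose a2 := hat (approval_vec m.+3 2).
pose i1 : 'I_m.+3 := lift ord0 0; pose i2 : 'I_m.+3 := lift ord0 (lift ord0 0).
have [i wi] := nontrivial_sum_zero_nonconstant w0 w_nontrivial.
have [C CE] := gr_act_onto_sum_zero wi r_pos0.
have u01 : (a1 - a2) 0 0 != (a1 - a2) i1 0.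
  by rewrite -subr_eq0 hatB_diff !mxE.
have u02 : (a1 - a2) 0 0 = (a1 - a2) i2 0.
  by apply/eqP; rewrite -subr_eq0 hatB_diff !mxE.
have rest0 : sum_zero (r_app - gr_act C a2).
  by apply: sum_zeroB => //; apply/sum_zero_gr_act/sum_zero_hat.
have [A AE] := gr_act_onto_sum_zero u01 rest0.
pose K : group_ring m.+3 := gr_delta 1 1%g - gr_delta 1 (tperm 0 i2).
have K1 : K 1%g = 1.
  rewrite !ffunE eqxx ifN ?subr0 //; apply/eqP => /permP /(_ 0).
  by rewrite perm1 tpermL.
pose p t := two_level_profile (A + K *+ t) (C - (A + K *+ t)).
have p_inj : injective p.
  (* t is read off from the coefficient of the identity in A + t K. *)
  move=> s t /ffunP /(_ 0); rewrite !ffunE /= => /addrI /ffunP /(_ 1%g).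
  rewrite !ffunMnE K1 => /eqP.
  by rewrite eqr_nat => /eqP.
move=> fin; apply: infinite_nat.
rewrite (_ : [set: nat]%classic =
    (p @^-1` [set p : ranked_approval_profile m.+3 |
      approval_outcome p = r_app /\ positional_outcome w p = r_pos])%classic).
  by apply: finite_preimage fin => s t _ _; apply: p_inj.
apply/esym/seteqP; split=> // t _; split=> /=.
  rewrite approval_outcome_two_level gr_actB addrCA -gr_actBr -/a1 -/a2.
  by rewrite gr_actD gr_actMn AE gr_act_1_tperm // mul0rn addr0 addrC subrK.
by rewrite positional_outcome_two_level addrC subrK hat_id.
Qed.
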